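(* Let $q$ be a prime power, $P \in \mathbb{F}_q[x]$ an irreducible polynomial, $k \geq 1$, and $D \subset \mathrm{Div}(P^k)$ with $P^k \notin D$; put $s = |D|$. Then the clique number and the chromatic number of $G_{P^k}(D)$ are both equal to $|P|^{|D|} = |P|^s$.
   Context: $|P| = q^{\deg P}$, while $|D|$ is the cardinality of the finite set $D$. For a nonconstant $f \in \mathbb{F}_q[x]$, $\mathrm{Div}(f)$ is the set of divisors of $f$ up to multiplication by nonzero constants; for $D \subset \mathrm{Div}(f)$ with $f \notin D$, the gcd-graph $G_f(D)$ is the simple undirected graph with vertex set $\mathbb{F}_q[x]/f$ in which $a,b$ are adjacent iff $\gcd(a-b,f) \in D$ (gcd taken up to nonzero constants). *)

(* Defs.v *)
From HB Require Import structures.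
From mathcomp Require Import all_boot all_order all_algebra all_field.
From mathcomp Require Import finmap.

Set Implicit Arguments.
Unset Strict Implicit.
Unset Printing Implicit Defensive.

Import GRing.Theory.
Local Open Scope ring_scope.
Local Open Scope fset_scope.

Record sgraph := SGraph {
  vertex :> finType;
  adj : rel vertex;
  adj_sym : symmetric adj;
  adj_irr : irreflexive adj
}.

Definition is_clique (G : sgraph) (A : {set G}) : bool :=
  [forall x in A, forall y in A, (x != y) ==> adj x y].

Definition clique_number (G : sgraph) : nat :=
  (\max_(A : {set G} | is_clique A) #|A|)%N.

Definition colorable (G : sgraph) (n : nat) : bool :=
  [exists c : {ffun G -> 'I_n}, forall x, forall y, adj x y ==> (c x != c y)].

Lemma colorable_ex (G : sgraph) : exists n, colorable G n.
Proof.
exists #|G|; apply/existsP; exists [ffun x => enum_rank x].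
apply/forallP => x; apply/forallP => y; apply/implyP => xy.
rewrite !ffunE; apply: contraTneq xy => /enum_rank_inj ->.
by rewrite adj_irr.
Qed.

Definition chromatic_number (G : sgraph) : nat := ex_minn (colorable_ex G).

Section GcdGraph.
Variable F : finFieldType.
Implicit Types (f p : {poly F}) (D : {fset {poly F}}).

(* The class of a nonzero p up to multiplication by nonzero constants is
   represented by its unique monic element. *)
Definition monic_rep p : {poly F} := (lead_coef p)^-1 *: p.

Lemma monic_rep_monic p : p != 0 -> monic_rep p \is monic.
Proof. by move=> p0; rewrite monicE lead_coefZ mulVf // lead_coef_eq0. Qed.

Lemma monic_rep_eqp p : p != 0 -> monic_rep p %= p.
Proof. by move=> p0; rewrite eqp_scale // invr_eq0 lead_coef_eq0. Qed.

Lemma eqp_monic_rep p r : p %= r -> monic_rep p = monic_rep r.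
Proof.
have [-> | p0 pr] := eqVneq p 0; first by rewrite eqp_sym eqp0 => /eqP ->.
have r0 : r != 0 by apply: contraNneq p0 => r0; rewrite -eqp0 -r0.
apply/eqP; rewrite -eqp_monic ?monic_rep_monic //.
apply: eqp_trans (monic_rep_eqp p0) (eqp_trans pr _).
by rewrite eqp_sym monic_rep_eqp.
Qed.

Definition Div f : {pred {poly F}} := [pred d | (d \is monic) && (d %| f)].

(* {poly %/ h} is only F[x]/(h) when h is monic and nonconstant, hence the use
   of monic_rep f, which generates the same ideal as f. Its elements coerce to
   their remainders modulo f. Only nonconstant f are meaningful here. *)
Definition gcd_vertex f := {poly %/ (monic_rep f)}.

Definition gcd_adj f D : rel (gcd_vertex f) :=
  fun a b => monic_rep (gcdp (a - b : gcd_vertex f) f) \in D.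

Lemma gcd_adj_sym f D : symmetric (@gcd_adj f D).
Proof.
suff H (a b : gcd_vertex f) : gcd_adj D a b -> gcd_adj D b a.
  by move=> a b; apply/idP/idP; apply: H.
rewrite /gcd_adj (@eqp_monic_rep _ (gcdp (b - a : gcd_vertex f) f)) //.
apply: eqp_gcdl; rewrite -opprB /=; apply/eqpP.
by exists (1, -1); rewrite /= ?oppr_eq0 ?oner_neq0 // scale1r scaleN1r.
Qed.

Lemma gcd_adj_irr f D : monic_rep f \notin D -> irreflexive (@gcd_adj f D).
Proof. by move=> fD a; rewrite /gcd_adj subrr gcd0p (negbTE fD). Qed.

Definition gcd_graph f D (fD : monic_rep f \notin D) : sgraph :=
  SGraph (@gcd_adj_sym f D) (gcd_adj_irr fD).

Definition poly_norm p : nat := (#|F| ^ (size p).-1)%N.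

End GcdGraph.

(* Main.v *)
Require Import Defs.
From mathcomp Require Import all_boot all_order all_algebra all_field.
From mathcomp Require Import finmap.
Local Open Scope ring_scope.
Local Open Scope fset_scope.
Import GRing.Theory.

(* By unique factorization D consists, up to constants, of powers P^i with
   i < k.  Write residues modulo P^k in base P.  Then gcd(a - b, P^k) is P^i
   for the first index i at which the digits of a and b differ.  So reading
   the digits at the exponents of D is a proper colouring, the residues whose
   other digits vanish form a clique, and both have |P|^s values. *)

(** A proper colouring is injective on a clique, so no clique outnumbers the colours of any
    colouring. The image of [g] and the colouring [c] meet this bound with the same size. *)
Lemma clique_number_chromatic_number (G : sgraph) (T : finType)
    (c : G -> T) (g : T -> G) :
    (forall x y, adj x y -> c x != c y) ->
    (forall s t, s != t -> adj (g s) (g t)) ->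
  clique_number G = #|T| /\ chromatic_number G = #|T|.
Proof.
move=> cP gP.
have g_inj : injective g.
  move=> s t gst; apply/eqP/contraT => /gP.
  by rewrite gst adj_irr.
have clique_g : is_clique (G := G) [set g t | t in T].
  apply/forall_inP => _ /imsetP[s _ ->]; apply/forall_inP => _ /imsetP[t _ ->].
  by apply/implyP => gst; apply: gP; apply: contraNneq gst => ->.
have color_c : colorable G #|T|.
  apply/existsP; exists [ffun x => enum_rank (c x)].
  apply/forallP => x; apply/forallP => y; apply/implyP => /cP.
  by rewrite !ffunE (inj_eq enum_rank_inj).
have clique_le A n : is_clique (G := G) A -> colorable G n -> (#|A| <= n)%N.
  move=> /forall_inP clA /existsP[f /forallP fP].
  rewrite -[n]card_ord -(card_in_imset (f := f) (D := mem A)) ?max_card //.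
  move=> x y xA yA fxy; apply/eqP/contraT => xy.
  have /forall_inP /(_ y yA) := clA x xA.
  by rewrite xy /= => xy'; have /forallP /(_ y) := fP x; rewrite xy' fxy eqxx.
have card_g : #|[set g t | t in T]| = #|T| by rewrite card_imset.
split; apply/eqP; rewrite eqn_leq.
  apply/andP; split; first by apply/bigmax_leqP => A clA; apply: clique_le.
  by rewrite -card_g /clique_number (leq_bigmax_cond _ clique_g).
rewrite /chromatic_number; case: ex_minnP => n color_n n_min.
by rewrite n_min //= -card_g clique_le.
Qed.

Section IrreduciblePower.
Context {F : fieldType} {P : {poly F}}.
Hypothesis irrP : irreducible_poly P.

Lemma dvdp_irreducible_exp {k : nat} {d : {poly F}} :
  d %| P ^+ k -> exists i, d %= P ^+ i.
Proof.
elim: k d => [|k IHk] d; first by rewrite expr0 dvdp1 size_poly_eq1; exists 0%N.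
have [/dvdpP[e ->]|ndPd] := boolP (P %| d).
  rewrite exprSr dvdp_mul2r ?irredp_neq0 // => /IHk[i ei].
  by exists i.+1; rewrite exprSr eqp_mul2r ?irredp_neq0.
rewrite exprS Gauss_dvdpr; first exact: IHk.
by rewrite coprimep_sym irreducible_poly_coprime.
Qed.

(** The divisors of [P ^+ k] form a chain, and each strict step up gains at least one factor [P].
    This replaces any computation with exponents below. *)
Lemma dvdp_irreducible_exp_total {k : nat} {d e : {poly F}} :
  d %| P ^+ k -> e %| P ^+ k -> ~~ (d %| e) -> e * P %| d.
Proof.
move=> /dvdp_irreducible_exp[i di] /dvdp_irreducible_exp[j ej].
rewrite (eqp_dvdl _ di) (eqp_dvdr _ ej) (eqp_dvdr _ di).
rewrite (eqp_dvdl _ (eqp_mulr P ej)) -exprSr.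
by case: (leqP i j) => [ij|ji _]; rewrite dvdp_exp2l.
Qed.

End IrreduciblePower.

Section GcdGraphPower.
Variables (F : finFieldType) (P : {poly F}) (k : nat) (D : {fset {poly F}}).
Hypotheses (irrP : irreducible_poly P) (k_gt0 : (0 < k)%N).
Hypothesis subD : {subset D <= Div (P ^+ k)}.
Hypothesis PkD : monic_rep (P ^+ k) \notin D.

Let monD (e : D) : val e \is monic.
Proof. by have /andP[] := subD _ (valP e). Qed.

Let dvdD (e : D) : val e %| P ^+ k.
Proof. by have /andP[] := subD _ (valP e). Qed.

Let monic_repD (e : D) : monic_rep (val e) = val e.
Proof. by rewrite /monic_rep (monicP (monD e)) invr1 scale1r. Qed.

Let Pk_neq0 : P ^+ k != 0.
Proof. by rewrite expf_neq0 ?irredp_neq0. Qed.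

Let Pk_size : (1 < size (monic_rep (P ^+ k)))%N.
Proof.
rewrite (eqp_size (monic_rep_eqp Pk_neq0)) (leq_trans irrP.1) //.
by rewrite dvdp_leq // dvdp_exp.
Qed.

(** Size at most [(size P).-1] means degree below that of [P]: one representative for each residue
    modulo [P]. *)
Let digits := {ffun D -> {poly_(size P).-1 F}}.

Definition digits_of (a : gcd_graph PkD) : digits :=
  [ffun e : D => npolyp _ ((a : {poly F}) %/ val e %% P)].

Definition poly_of_digits (t : digits) : {poly F} :=
  \sum_e (t e : {poly F}) * val e.

Definition vertex_of_digits (t : digits) : gcd_graph PkD :=
  in_qpoly _ (poly_of_digits t).

Lemma digits_of_adj (a b : gcd_graph PkD) :
  adj a b -> digits_of a != digits_of b.
Proof.
rewrite /= /gcd_adj; set w : {poly F} := polyn (a - b).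
move=> gD; apply/eqP => /ffunP /(_ [` gD]); set e : D := [` gD].
have eg : val e %= gcdp w (P ^+ k).
  by rewrite monic_rep_eqp // gcdp_eq0 negb_and Pk_neq0 orbT.
(* Since the class of [P ^+ k] is not in [D], [e] is a proper divisor, which leaves room for one
   more factor [P]. *)
have eP_Pk : val e * P %| P ^+ k.
  apply: (dvdp_irreducible_exp_total irrP (dvdpp _) (dvdD e)).
  apply: contra PkD => Pk_e.
  have /eqp_monic_rep <- : val e %= P ^+ k by rewrite /eqp dvdD.
  by rewrite monic_repD; apply: valP.
have e0 : val e != 0 by rewrite monic_neq0.
rewrite !ffunE => /(congr1 (fun p : {poly_ _ F} => p : {poly F})).
have szP (p : {poly F}) : (size (p %% P)%R <= (size P).-1)%N.
  by rewrite -ltnS prednK ?size_poly_gt0 ?ltn_modp irredp_neq0.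
rewrite !npolypK // => /eqP; rewrite -subr_eq0 -modpN -modpD -divpN -divpD.
have -> : (a : {poly F}) - (b : {poly F}) = w by [].
rewrite -[_ == 0]/(P %| _) -(dvdp_mul2r _ _ e0) divpK; last first.
  by rewrite (eqp_dvdl _ eg) dvdp_gcdl.
rewrite mulrC => eP_w.
(* Equal digits at [e] make [e * P] a common divisor of [w] and [P ^+ k], hence a divisor of their
   gcd [e], so [P] would be a unit. *)
have : val e * P %| val e by rewrite (eqp_dvdr _ eg) dvdp_gcd eP_w.
rewrite -{2}[val e]mulr1 dvdp_mul2l // dvdp1 => /eqP szP1.
by case: irrP; rewrite szP1.
Qed.

Lemma vertex_of_digits_adj (s t : digits) :
  s != t -> adj (vertex_of_digits s) (vertex_of_digits t).
Proof.
move=> st; rewrite /= /gcd_adj.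
have /existsP[e1 e1P] : [exists e, s e != t e].
  apply: contraR st; rewrite negb_exists => /forallP st.
  by apply/eqP/ffunP => e; apply/eqP; have := st e; rewrite negbK.
(* Least size means lowest power of [P], so [e0] marks the first differing digit and should be the
   gcd. *)
have [e0 e0P e0_min] := arg_minnP (P := fun e => s e != t e)
  (fun e => size (val e)) e1P.
pose d e : {poly F} := polyn (s e - t e).
set w := poly_of_digits s - poly_of_digits t.
have w_sum : w = \sum_e d e * val e.
  by rewrite /w -sumrB; apply: eq_bigr => e _; rewrite -mulrBl.
have e00 : val e0 != 0 by rewrite monic_neq0.
(* The terms of w other than that of e0 vanish or are divisible by e0 * P. *)
have [z wE] : exists z, w = val e0 * (d e0 + P * z).
  suff /dvdpP[z zP] : val e0 * P %| w - d e0 * val e0.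
    by exists z; rewrite mulrDr mulrA [_ * z]mulrC -zP mulrC addrC subrK.
  rewrite w_sum (bigD1 e0) //= [X in X - _]addrC addrK.
  apply: (big_ind (fun p => val e0 * P %| p)) => [|p q|e ne].
  - exact: dvdp0.
  - exact: dvdp_add.
  have [ste | ste] := eqVneq (s e) (t e).
    by rewrite /d ste subrr mul0r dvdp0.
  rewrite dvdp_mull //.
  apply: (dvdp_irreducible_exp_total irrP (dvdD e) (dvdD e0)).
  (* If [e] divided [e0], minimality would force equal sizes, and monic associates coincide. *)
  apply: contra ne => e_e0; apply/eqP/val_inj/eqP.
  rewrite -eqp_monic // -dvdp_size_eqp // eqn_leq e0_min // andbT.
  by rewrite dvdp_leq.
(* The digit difference [d e0] is nonzero and of smaller degree than [P]. *)
have ndP : ~~ (P %| d e0 + P * z).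
  rewrite dvdp_addl ?dvdp_mulr //; apply/negP => /dvdp_leq P_le.
  have : (size P <= size (d e0))%N by apply: P_le; rewrite /d subr_eq0.
  apply/negP; rewrite -ltnNge -[size P]prednK ?size_poly_gt0 ?irredp_neq0 //.
  by rewrite ltnS size_npoly.
set g := gcdp _ _.
have gE : g %= gcdp w (P ^+ k).
  (* Reducing [w] modulo an associate of [P ^+ k] leaves its gcd with [P ^+ k] unchanged up to
     constants. *)
  have -> : g = gcdp (w %% monic_rep (P ^+ k)) (P ^+ k).
    rewrite /g /vertex_of_digits -raddfB /= /mk_monic monic_rep_monic //.
    by rewrite Pk_size -Pdiv.IdomainMonic.modpE ?monic_rep_monic.
  have f_eqp := monic_rep_eqp Pk_neq0.
  apply: eqp_trans (eqp_trans (gcdp_modl w (monic_rep (P ^+ k))) _).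
    by apply: eqp_gcdr; rewrite eqp_sym.
  exact: eqp_gcdr.
suff /eqp_monic_rep -> : g %= val e0.
  by rewrite monic_repD; apply: valP.
rewrite (eqp_ltrans gE) /eqp dvdp_gcd dvdD wE dvdp_mulr // !andbT.
(* A gcd not dividing [e0] would be a multiple of [e0 * P], putting a factor [P] into the cofactor
   of [e0] in [w]. *)
apply: contraNT ndP => ndg.
rewrite -(dvdp_mul2l _ _ e00) -wE.
apply: dvdp_trans (dvdp_gcdl w (P ^+ k)).
apply: (dvdp_irreducible_exp_total irrP _ (dvdD e0)); first exact: dvdp_gcdr.
by rewrite wE.
Qed.

Lemma card_digits : #|digits| = (poly_norm P ^ #|` D|)%N.
Proof. by rewrite card_ffun card_npoly cardfE. Qed.

End GcdGraphPower.

Theorem corollary3p7 (F : finFieldType) (P : {poly F}) (k : nat)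
    (D : {fset {poly F}}) (irrP : irreducible_poly P) (k_gt0 : (0 < k)%N)
    (subD : {subset D <= Div (P ^+ k)}) (PkD : monic_rep (P ^+ k) \notin D) :
  clique_number (gcd_graph PkD) = (poly_norm P ^ #|` D|)%N /\
  chromatic_number (gcd_graph PkD) = (poly_norm P ^ #|` D|)%N.
Proof.
rewrite -card_digits.
apply: clique_number_chromatic_number.
  exact: digits_of_adj irrP subD PkD.
exact: vertex_of_digits_adj irrP k_gt0 subD PkD.
Qed.
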